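(* Let $r$ and $s$ be positive integers with $r\geq 2s-2$, and let $G$ be a finite simple graph of order $n=3r+4s$ with $\sigma_{2}(G)\geq n+r$. Then $G$ contains $r$ triangles and $s$ quadrilaterals, all pairwise vertex-disjoint (i.e. $G\supseteq rC_{3}\cup sC_{4}$).
   Context: All graphs are finite, simple and undirected. For a graph $G$, $\sigma_{2}(G)=\min\{d(x)+d(y): x,y\in V(G),\ x\neq y,\ xy\notin E(G)\}$, where $d(v)$ is the degree of $v$; if $G$ is complete, $\sigma_2(G)=\infty$. $C_3$ is a triangle (cycle on 3 vertices) and $C_4$ a quadrilateral (cycle on 4 vertices); $rC_3\cup sC_4$ denotes $r+s$ vertex-disjoint cycles, $r$ of length 3 and $s$ of length 4, and containment means as (not necessarily induced) subgraphs. *)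

(* Defs.v *)
From mathcomp Require Import all_boot.
Set Implicit Arguments. Unset Strict Implicit. Unset Printing Implicit Defensive.

Definition simple_graph (T : finType) (e : rel T) : Prop :=
  symmetric e /\ irreflexive e.

Definition deg (T : finType) (e : rel T) (x : T) : nat := #|[set y | e x y]|.

(* sigma_2(G) >= k : every pair of distinct non-adjacent vertices has degree sum >= k
   (vacuous when G is complete, matching sigma_2 = infinity). *)
Definition sigma2_ge (T : finType) (e : rel T) (k : nat) : Prop :=
  forall x y : T, x != y -> ~~ e x y -> k <= deg e x + deg e y.

(* G contains r C_3 \cup s C_4: an injective labelling of the vertices of
   r disjoint triangles and s disjoint quadrilaterals such that consecutive
   vertices on each cycle are adjacent in G. Injectivity = vertex-disjointness
   and distinct vertices on each cycle. *)
Definition contains_rC3_sC4 (T : finType) (e : rel T) (r s : nat) : Prop :=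
  exists f : ('I_r * 'I_3) + ('I_s * 'I_4) -> T,
    injective f /\
    (forall (i : 'I_r) (j : 'I_3), e (f (inl (i, j))) (f (inl (i, ordS j)))) /\
    (forall (i : 'I_s) (j : 'I_4), e (f (inr (i, j))) (f (inr (i, ordS j)))).

(* Main.v *)
Require Import Defs.
From mathcomp Require Import all_boot zify.

(* Write k = r + s, so that sigma_2 >= 4k.  Adding an edge to G keeps this
   hypothesis, so by induction on the number of nonadjacent pairs G + xy has the
   required factor.  Hence so has G, or G has all the cycles of the factor but
   one, the vertices of the last cycle, of length 3 or 4, being joined by a path.
   Nonadjacent vertices of such a leftover have a large degree sum, so that some
   cycle receives more edges from them than it should on average, and the
   vertices of the leftover and of that cycle can be regrouped.  A path on 3
   vertices first takes in a quadrilateral to leave a path on 4 vertices, or a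
   triangle with five edges to its ends (the bowl below), which can take in
   another cycle in its turn; a path on 4 vertices is improved to a paw, and a
   paw to a quadrilateral.  In the case of the paw, a triangle can absorb weight
   6 and a quadrilateral weight 12, against an average of 8; this is where
   r >= 2s - 2 is used.  The regroupings concern at most 10 vertices and are
   checked by computation. *)

Set Implicit Arguments.
Unset Strict Implicit.
Unset Printing Implicit Defensive.

(** * Graphs on initial segments *)

(* A graph on the vertices 0, ..., n - 1 is the pair of n and a list of edges,
   each listed in one direction only. *)
Definition graph : Type := nat * seq (nat * nat).
Definition nverts (P : graph) : nat := P.1.
Definition edges (P : graph) : seq (nat * nat) := P.2.

Definition well_formed (P : graph) : bool :=
  all (fun ij => (ij.1 < nverts P) && (ij.2 < nverts P)) (edges P).

Definition path_graph (n : nat) : graph := (n, [seq (i, i.+1) | i <- iota 0 n.-1]).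
Definition cycle_graph (n : nat) : graph :=
  (n, [seq (i, i.+1 %% n) | i <- iota 0 n]).

Lemma well_formed_cycle_graph n : well_formed (cycle_graph n).
Proof. by rewrite /well_formed all_map; apply/allP => i /=; rewrite mem_iota; lia. Qed.

Definition add_edges (P : graph) (E : seq (nat * nat)) : graph :=
  (nverts P, edges P ++ E).

Definition disjoint_union (P Q : graph) : graph :=
  (nverts P + nverts Q,
   edges P ++ [seq (nverts P + ij.1, nverts P + ij.2) | ij <- edges Q]).
Local Infix ":+:" := disjoint_union (at level 50, left associativity).

Definition adjacent (E : seq (nat * nat)) (ij : nat * nat) : bool :=
  (ij \in E) || ((ij.2, ij.1) \in E).

Definition relabel (p : seq nat) (E : seq (nat * nat)) : seq (nat * nat) :=
  [seq (nth 0 p ij.1, nth 0 p ij.2) | ij <- E].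

Definition embeds (P Q : graph) (p : seq nat) : bool :=
  [&& nverts Q == nverts P, well_formed Q, perm_eq p (iota 0 (nverts Q))
    & all (adjacent (edges P)) (relabel p (edges Q))].

(* Each target graph comes with vertex orders that may exhibit it. *)
Definition targets : Type := seq (graph * seq (seq nat)).
Definition rows (K : targets) : seq (graph * seq nat) :=
  [seq (Qps.1, p) | Qps <- K, p <- Qps.2].
Definition reduces (P : graph) (K : targets) : bool :=
  has (fun Qp => embeds P Qp.1 Qp.2) (rows K).

Lemma mem_rows K Qp : Qp \in rows K -> Qp.1 \in unzip1 K.
Proof. by case/allpairsPdep=> Qps [p [QpsK _ ->]]; apply: map_f. Qed.

Definition cross (I J : seq nat) : seq (nat * nat) := [seq (i, j) | i <- I, j <- J].
Definition ends (D : seq (nat * nat)) : seq nat := unzip1 D ++ unzip2 D.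

Lemma sum_cross_undup (I J : seq nat) (a : pred (nat * nat)) :
  \sum_(v <- cross (undup I) J | a v) count_mem v.1 I = count a (cross I J).
Proof.
rewrite -sum1_count !(big_mkcond a) /cross !big_allpairs -[RHS]big_undup_iterop_count.
apply: eq_bigr => i _; rewrite Monoid.iteropE iter_addn_0 big_distrl /=.
by apply: eq_bigr => j _; case: ifP; rewrite ?mul1n.
Qed.

Section Unavoidable.

Variables (T : eqType) (w : T -> nat).

(* Branches on the first element v of V: if present, it is no longer required; if
   absent, at the cost w v, the lists requiring it are lost.  Conditionals instead
   of boolean connectives keep the evaluation lazy. *)
Fixpoint unavoidable (V : seq T) (d : nat) (Rs : seq (seq T)) : bool :=
  if has (@nilp T) Rs then true else
  if V is v :: V' then
    unavoidable V' d [seq [seq u <- R | u != v] | R <- Rs] &&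
    (if w v <= d then unavoidable V' (d - w v) [seq R <- Rs | v \notin R] else true)
  else false.

Lemma unavoidableP (a : pred T) V d Rs :
  unavoidable V d Rs -> \sum_(v <- V | ~~ a v) w v <= d -> has (all a) Rs.
Proof.
have nil_met : subpred (@nilp T) (all a) by move=> R /nilP->.
elim: V d Rs => [|v V IHV] d Rs /=; case: ifP => [/(sub_has nil_met)//|_] //.
case/andP=> kept dropped; rewrite big_cons; case: ifPn => [absent|/negPn present] le_d.
  rewrite (leq_trans (leq_addr _ _) le_d) in dropped.
  have /hasP[R] : has (all a) [seq R <- Rs | v \notin R] by apply: IHV dropped _; lia.
  by rewrite mem_filter => /andP[_ RRs] aR; apply/hasP; exists R.
have /hasP[_ /mapP[R RRs ->] /allP aR] := IHV _ _ kept le_d.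
apply/hasP; exists R => //; apply/allP => u uR.
by have [->//|neq_uv] := eqVneq u v; apply: aR; rewrite mem_filter neq_uv.
Qed.

End Unavoidable.

(** * Augmentations *)

Definition needs (V : seq (nat * nat)) (Qp : graph * seq nat) : seq (nat * nat) :=
  [seq v <- V | adjacent (relabel Qp.2 (edges Qp.1)) v].

(* The vertices of P are followed by those of an n-cycle.  The edges in between are
   unknown, except that more than A of them are present, each counted as often as
   its end in P occurs in ends D. *)
Definition absorbs (P : graph) (D : seq (nat * nat)) (n A : nat) (K : targets) :
    bool :=
  let V := cross (undup (ends D)) (iota (nverts P) n) in
  all (fun Qp => embeds (add_edges (P :+: cycle_graph n) (needs V Qp)) Qp.1 Qp.2)
      (rows K) &&
  unavoidable (fun v => count_mem v.1 (ends D)) V (size (ends D) * n - A.+1)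
              [seq needs V Qp | Qp <- rows K].

(* Bounds the sum of the degrees of the ends of D inside a graph on n vertices in
   which no pair of N is adjacent. *)
Definition inner_degrees (n : nat) (N D : seq (nat * nat)) : nat :=
  count (fun ij => (ij.1 != ij.2) && ~~ adjacent N ij) (cross (ends D) (iota 0 n)).

(* If a pair of nonedges is adjacent after all, then source reduces to a shortcut.
   Otherwise the pairs of demand, a list with repetitions, have a large degree
   sum, and some cycle, of length n, receives more than capacity n edges from
   their ends; source and that cycle then reduce to an outcome for n. *)
Record augmentation := Augmentation {
  source : graph;
  nonedges : seq (nat * nat);
  demand : seq (nat * nat);
  inner_bound : nat;
  shortcuts : targets;
  capacity : nat -> nat;
  outcomes : nat -> targets
}.

Definition valid (X : augmentation) (lengths : seq nat) : bool :=
  let h := nverts (source X) in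
  [&& well_formed (source X),
      all (fun ij => [&& ij.1 < h, ij.2 < h, ij.1 != ij.2 & ij \in nonedges X])
          (demand X),
      inner_degrees h (nonedges X) (demand X) <= inner_bound X,
      all (fun ij => reduces (add_edges (source X) [:: ij]) (shortcuts X)) (nonedges X)
    & all (fun n => absorbs (source X) (demand X) n (capacity X n) (outcomes X n))
          lengths].

Definition by_length (triangle quad n : nat) : nat := if n == 3 then triangle else quad.

Definition paw : graph := add_edges (path_graph 4) [:: (0, 2)].
Definition bowl : graph :=
  add_edges (path_graph 3 :+: cycle_graph 3)
            [:: (0, 3); (0, 4); (0, 5); (2, 3); (2, 4)].

(* The vertex orders in the following tables were found by computer search. *)
Definition paw_outcomes (n : nat) : targets :=
  [:: (cycle_graph n :+: cycle_graph 4,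
       if n == 3 then
         [:: [:: 0;1;2;3;4;5;6]; [:: 0;1;2;3;4;6;5]; [:: 0;1;2;3;5;4;6];
             [:: 0;4;5;1;2;3;6]; [:: 0;4;6;1;2;3;5]; [:: 0;5;6;1;2;3;4];
             [:: 1;4;5;0;2;3;6]; [:: 1;4;6;0;2;3;5]; [:: 1;5;6;0;2;3;4]]
       else
         [:: [:: 0;2;1;4;3;5;6;7]; [:: 0;2;1;5;3;4;7;6];
             [:: 0;2;1;6;3;5;4;7]; [:: 0;2;1;7;3;4;5;6]])].

Definition path4_outcomes (n : nat) : targets :=
  [:: (cycle_graph n :+: paw,
       if n == 3 then
         [:: [:: 0;1;5;2;3;4;6]; [:: 0;1;6;4;5;2;3]; [:: 0;4;5;3;6;2;1];
             [:: 3;4;5;2;6;1;0]; [:: 2;3;6;4;5;1;0]; [:: 3;4;6;2;5;1;0];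
             [:: 3;5;6;2;4;1;0]; [:: 0;1;4;5;6;2;3]; [:: 0;1;5;4;6;2;3];
             [:: 0;1;6;2;3;4;5]; [:: 0;1;6;2;3;5;4]; [:: 0;4;5;1;6;2;3];
             [:: 0;4;6;1;5;2;3]]
       else
         [:: [:: 0;1;2;4;3;5;6;7]; [:: 0;1;2;5;3;4;7;6]; [:: 0;1;4;5;6;7;2;3];
             [:: 1;2;3;5;0;6;7;4]; [:: 2;3;4;5;6;7;1;0]; [:: 2;3;7;4;0;1;6;5];
             [:: 0;1;5;4;2;3;6;7]; [:: 0;4;5;6;1;7;2;3]; [:: 2;3;5;4;0;1;7;6];
             [:: 2;3;4;7;5;6;1;0]; [:: 1;2;3;7;0;4;5;6]; [:: 2;3;7;6;4;5;1;0];
             [:: 0;1;2;6;3;5;4;7]; [:: 2;3;6;7;0;1;5;4]; [:: 0;1;6;7;2;3;4;5];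
             [:: 0;1;7;6;4;5;2;3]; [:: 0;1;6;5;2;3;7;4]; [:: 0;1;2;7;3;4;5;6]]);
      (cycle_graph n :+: cycle_graph 4,
       if n == 3 then
         [:: [:: 0;4;6;1;2;3;5]; [:: 0;5;6;1;2;3;4]; [:: 0;4;5;1;2;3;6];
             [:: 3;4;5;0;1;2;6]; [:: 3;4;6;0;1;2;5]; [:: 2;3;5;0;1;6;4]]
       else [:: [:: 0;1;4;7;2;3;6;5]])].

Definition path3_outcomes (n : nat) : targets :=
  if n == 3 then
    [:: (bowl, [:: [:: 0;1;2;3;4;5]; [:: 0;1;2;3;5;4]; [:: 0;1;2;4;5;3];
                   [:: 2;1;0;3;4;5]; [:: 2;1;0;3;5;4]; [:: 2;1;0;4;5;3]])]
  else
    [:: (cycle_graph 3 :+: path_graph 4,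
         [:: [:: 0;3;4;1;2;5;6]; [:: 0;5;6;1;2;3;4]; [:: 0;3;6;1;2;4;5];
             [:: 0;4;5;1;2;6;3]; [:: 2;3;4;1;0;5;6]; [:: 2;3;6;1;0;4;5];
             [:: 2;4;5;1;0;6;3]; [:: 2;5;6;1;0;3;4]])].

(* A quadrilateral that receives weight more than 12 from the bowl receives more
   than 4 edges from 0 and 2, or from 1 and 5.  It is then regrouped as in
   path3_outcomes with the path 0 1 2 or 1 0 5, the other three vertices of the
   bowl forming a triangle. *)
Definition bowl_outcomes (n : nat) : targets :=
  [:: (cycle_graph 3 :+:
         (cycle_graph 3 :+: (if n == 3 then cycle_graph 3 else path_graph 4)),
       if n == 3 then
         [:: [:: 0;1;6;2;3;4;5;7;8]; [:: 0;1;7;2;3;4;5;6;8];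
             [:: 0;5;6;2;3;4;1;7;8]; [:: 0;5;7;2;3;4;1;6;8];
             [:: 0;5;8;2;3;4;1;6;7]; [:: 0;3;4;2;1;6;5;7;8];
             [:: 0;1;7;2;6;8;3;4;5]; [:: 0;3;4;2;1;7;5;6;8];
             [:: 0;1;8;2;6;7;3;4;5]; [:: 0;3;4;2;1;8;5;6;7];
             [:: 0;6;7;2;1;8;3;4;5]; [:: 0;6;8;2;1;7;3;4;5]]
       else
         [:: [:: 3;4;5;0;6;7;1;2;8;9]; [:: 3;4;5;0;8;9;1;2;6;7];
             [:: 3;4;5;0;6;9;1;2;7;8]; [:: 3;4;5;0;7;8;1;2;9;6];
             [:: 3;4;5;2;6;7;1;0;8;9]; [:: 3;4;5;2;6;9;1;0;7;8];
             [:: 3;4;5;2;7;8;1;0;9;6]; [:: 3;4;5;2;8;9;1;0;6;7];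
             [:: 2;3;4;1;6;7;0;5;8;9]; [:: 2;3;4;1;8;9;0;5;6;7];
             [:: 2;3;4;1;6;9;0;5;7;8]; [:: 2;3;4;1;7;8;0;5;9;6];
             [:: 2;3;4;5;6;7;0;1;8;9]; [:: 2;3;4;5;6;9;0;1;7;8];
             [:: 2;3;4;5;7;8;0;1;9;6]; [:: 2;3;4;5;8;9;0;1;6;7]])].

Definition paw_augmentation : augmentation := {|
  source := paw;
  nonedges := [:: (0, 3); (1, 3)];
  demand := [:: (0, 3); (1, 3)];
  inner_bound := 6;
  shortcuts := [:: (cycle_graph 4, [:: [:: 0;1;2;3]; [:: 1;0;2;3]])];
  capacity := by_length 6 12;
  outcomes := paw_outcomes
|}.

Lemma valid_paw_augmentation : valid paw_augmentation [:: 3; 4].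
Proof. by vm_compute. Qed.

Definition path4_augmentation : augmentation := {|
  source := path_graph 4;
  nonedges := [:: (0, 2); (1, 3); (0, 3)];
  demand := [:: (0, 2); (1, 3)];
  inner_bound := 6;
  shortcuts :=
    [:: (cycle_graph 4, [:: [:: 0;1;2;3]]); (paw, [:: [:: 0;1;2;3]; [:: 3;2;1;0]])];
  capacity := by_length 7 10;
  outcomes := path4_outcomes
|}.

Lemma valid_path4_augmentation : valid path4_augmentation [:: 3; 4].
Proof. by vm_compute. Qed.

Definition path3_augmentation : augmentation := {|
  source := path_graph 3;
  nonedges := [:: (0, 2)];
  demand := [:: (0, 2)];
  inner_bound := 2;
  shortcuts := [:: (cycle_graph 3, [:: [:: 0;1;2]])];
  capacity := by_length 4 4;
  outcomes := path3_outcomes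
|}.

Lemma valid_path3_augmentation : valid path3_augmentation [:: 3; 4].
Proof. by vm_compute. Qed.

Definition bowl_augmentation : augmentation := {|
  source := bowl;
  nonedges := [:: (0, 2); (1, 5); (1, 3); (1, 4)];
  demand := [:: (0, 2); (1, 5); (1, 5)];
  inner_bound := 20;
  shortcuts :=
    [:: (cycle_graph 3 :+: cycle_graph 3,
         [:: [:: 0;2;1;3;4;5]; [:: 0;5;1;2;3;4]; [:: 2;3;1;0;4;5]; [:: 2;4;1;0;5;3]])];
  capacity := by_length 12 12;
  outcomes := bowl_outcomes
|}.

Lemma valid_bowl_augmentation : valid bowl_augmentation [:: 3; 4].
Proof. by vm_compute. Qed.

(** * Leftovers of partial cycle factors *)

Definition few_quads (c : nat) (ns : seq nat) : bool :=
  all (mem [:: 3; 4]) ns && (2 * count_mem 4 ns <= count_mem 3 ns + c).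

Lemma few_quads_perm c ns ns' :
  perm_eq ns ns' -> few_quads c ns = few_quads c ns'.
Proof. by move=> pns; rewrite /few_quads (perm_all _ pns) !(permP pns). Qed.

Lemma few_quads_cons3 c ns : few_quads c (3 :: ns) = few_quads c.+1 ns.
Proof. by rewrite /few_quads /= add0n addnC addnS addSn addnC. Qed.

Lemma few_quads_cons4 c ns : few_quads c.+2 (4 :: ns) = few_quads c ns.
Proof. by rewrite /few_quads /= add0n mulnDr !addnS !ltnS. Qed.

Lemma sum_by_length t q c ns : few_quads c ns ->
  \sum_(n <- ns) by_length t q n = t * count_mem 3 ns + q * count_mem 4 ns.
Proof.
case/andP=> + _; elim: ns => [|n ns IHns] /=; first by rewrite big_nil !muln0.
by rewrite big_cons !inE => /andP[/orP[]/eqP-> /IHns->]; rewrite /by_length /=; lia.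
Qed.

Lemma size_few_quads c ns :
  few_quads c ns -> size ns = count_mem 3 ns + count_mem 4 ns.
Proof.
move/(sum_by_length 1 1); rewrite !mul1n => <-; rewrite -sum1_size.
by apply: eq_bigr => n _; rewrite /by_length if_same.
Qed.

Lemma few_quads_subset c ns : few_quads c ns -> {subset ns <= [:: 3; 4]}.
Proof. by case/andP=> /allP. Qed.

Lemma cycleP (T : Type) (e : rel T) (x0 : T) l :
  reflect (forall i, i < size l -> e (nth x0 l i) (nth x0 l (i.+1 %% size l)))
          (cycle e l).
Proof.
case: l => [|x p] /=; first by left.
have nth_succ i : i < size (rcons p x) ->
    nth x0 (x :: p) (i.+1 %% (size p).+1) = nth x0 (rcons p x) i.
  rewrite size_rcons ltnS nth_rcons leq_eqVlt => /predU1P[->|lt_i].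
    by rewrite modnn ltnn eqxx.
  by rewrite modn_small // lt_i.
have nth_cons i : i < size (rcons p x) ->
    nth x0 (x :: rcons p x) i = nth x0 (x :: p) i.
  by rewrite -rcons_cons nth_rcons size_rcons /= => ->.
apply: (iffP (pathP x0)) => e_l i lt_i.
  by rewrite nth_succ ?size_rcons // -nth_cons ?size_rcons // e_l ?size_rcons.
by rewrite nth_cons // -nth_succ // e_l // -(size_rcons p x).
Qed.

Section Graph.

Variables (T : finType) (e : rel T) (x0 : T).

Definition edge_at (l : seq T) (ij : nat * nat) : bool :=
  e (nth x0 l ij.1) (nth x0 l ij.2).
Definition realizes (l : seq T) (P : graph) : bool :=
  (size l == nverts P) && all (edge_at l) (edges P).

Lemma realizes_cycle l n : realizes l (cycle_graph n) = (size l == n) && cycle e l.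
Proof.
rewrite /realizes; have [<-|] := eqVneq (size l) n; last by [].
rewrite /= all_map; apply/allP/(cycleP _ x0 _) => /= e_l i.
  by move=> lt_i; apply: e_l; rewrite mem_iota.
by rewrite mem_iota => /e_l.
Qed.

Lemma realizes_path l n : realizes l (path_graph n) = (size l == n) && sorted e l.
Proof.
rewrite /realizes; have [<-|] := eqVneq (size l) n; last by [].
rewrite /= all_map; apply/allP/(sortedP x0) => /= e_l i.
  by move=> lt_i; apply: e_l; rewrite mem_iota; lia.
by rewrite mem_iota => lt_i; apply: e_l => /=; lia.
Qed.

Lemma realizes_add_edges l P E :
  realizes l (add_edges P E) = realizes l P && all (edge_at l) E.
Proof. by rewrite /realizes all_cat andbA. Qed.

Lemma realizes_union l P Q : well_formed P ->
  realizes l (P :+: Q) =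
    realizes (take (nverts P) l) P && realizes (drop (nverts P) l) Q.
Proof.
move=> /allP wfP; rewrite /realizes all_cat all_map size_drop size_take_min /=.
have -> : all (edge_at (take (nverts P) l)) (edges P) =
    all (edge_at l) (edges P).
  by apply: eq_in_all => ij /wfP/andP[i1 i2]; rewrite /edge_at !nth_take.
have -> : all (edge_at (drop (nverts P) l)) (edges Q) =
    all (preim (fun ij => (nverts P + ij.1, nverts P + ij.2)) (edge_at l))
      (edges Q).
  by apply: eq_all => ij; rewrite /edge_at /= !nth_drop.
by rewrite andbACA; congr (_ && _); lia.
Qed.

Definition tiling (ps : seq (seq T)) (H : seq T) : bool :=
  all (cycle e) ps && perm_eq (H ++ flatten ps) (enum T).

(* ns is the multiset of the cycle lengths, H lists the vertices left over. *)
Definition tiled (ns : seq nat) (H : seq T) : Prop :=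
  exists2 ps, perm_eq (shape ps) ns & tiling ps H.

Definition cycle_factor (ns : seq nat) : Prop := tiled ns [::].

Definition leaves (ns : seq nat) (P : graph) : Prop :=
  exists2 H, realizes H P & tiled ns H.

Lemma tiled_perm ns ns' H H' :
  perm_eq ns ns' -> perm_eq H H' -> tiled ns H -> tiled ns' H'.
Proof.
move=> pns pH [ps pps /andP[cyc pT]]; exists ps; first exact: perm_trans pns.
rewrite /tiling cyc; apply: perm_trans pT.
by rewrite perm_cat2r perm_sym.
Qed.

Lemma cycle_factor_perm ns ns' :
  perm_eq ns ns' -> cycle_factor ns -> cycle_factor ns'.
Proof. by move=> pns; apply: tiled_perm. Qed.

Lemma leaves_perm ns ns' P : perm_eq ns ns' -> leaves ns P -> leaves ns' P.
Proof. by move=> pns [H rH tH]; exists H => //; apply: tiled_perm tH. Qed.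

Lemma tiled_uniq ns H : tiled ns H -> uniq H.
Proof.
case=> ps _ /andP[_ /perm_uniq]; rewrite enum_uniq cat_uniq.
by case/and3P.
Qed.

Lemma tiled_cycle ns p H :
  cycle e p -> tiled ns (p ++ H) -> tiled (size p :: ns) H.
Proof.
move=> cyc_p [ps pps /andP[cyc pT]]; exists (p :: ps).
  by rewrite /= perm_cons.
rewrite /tiling /= cyc_p cyc; apply: perm_trans pT.
by rewrite perm_catCA catA.
Qed.

Lemma tiling_rem p ps H : p \in ps -> tiling ps H -> tiling (rem p ps) (H ++ p).
Proof.
move=> p_ps /andP[/allP cyc pT]; apply/andP; split.
  by apply/allP => q /mem_rem/cyc.
apply: perm_trans pT; rewrite -catA perm_cat2l perm_sym.
exact: (perm_flatten (perm_to_rem p_ps)).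
Qed.

Lemma perm_shape_rem p (ps : seq (seq T)) ns :
  p \in ps -> perm_eq (shape ps) ns -> perm_eq ns (size p :: shape (rem p ps)).
Proof.
move=> /perm_to_rem/(perm_map size) pps pns.
by apply: perm_trans pps; rewrite perm_sym.
Qed.

Lemma leaves_cycle_union ns n Q :
  leaves ns (cycle_graph n :+: Q) -> leaves (n :: ns) Q.
Proof.
case=> H; rewrite (realizes_union _ _ (well_formed_cycle_graph n)) realizes_cycle.
move=> /andP[/andP[/eqP sz cyc] rQ] tH.
exists (drop n H) => //; rewrite -{1}sz; apply: tiled_cycle => //.
by rewrite cat_take_drop.
Qed.

Lemma leaves_cycle ns n : leaves ns (cycle_graph n) -> cycle_factor (n :: ns).
Proof.
case=> H; rewrite realizes_cycle => /andP[/eqP<- cyc] tH.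
by apply: tiled_cycle; rewrite ?cats0.
Qed.

Lemma tiled_average (W : T -> nat) (A : nat -> nat) ns H :
  tiled ns H -> \sum_(y <- H) W y + \sum_(n <- ns) A n < \sum_y W y ->
  exists p ns', [/\ perm_eq ns (size p :: ns'), cycle e p,
    A (size p) < \sum_(y <- p) W y & tiled ns' (H ++ p)].
Proof.
case=> ps pns tps lt_sum; have /andP[/allP cyc pT] := tps.
have [/hasP[p p_ps lt_p]|/hasPn no_p] :=
  boolP (has (fun p => A (size p) < \sum_(y <- p) W y) ps).
  exists p, (shape (rem p ps)); split; rewrite ?cyc //; first exact: perm_shape_rem.
  by exists (rem p ps) => //; apply: tiling_rem.
move: lt_sum; rewrite ltnNge -big_enum -(perm_big _ pT) big_cat leq_add2l.
rewrite big_flatten -(perm_big _ pns) big_map /= !big_seq leq_sum // => p p_ps.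
by rewrite leqNgt no_p.
Qed.

Definition edges_from (I : seq nat) (H : seq T) (y : T) : nat :=
  \sum_(i <- I) e (nth x0 H i) y.

Lemma sum_edges_from I l J :
  \sum_(y <- [seq nth x0 l j | j <- J]) edges_from I l y =
    count (edge_at l) (cross I J).
Proof.
rewrite big_map exchange_big -sum1_count [RHS]big_mkcond /cross big_allpairs /=.
by apply: eq_bigr => i _; apply: eq_bigr => j _; rewrite /edge_at; case: (e _ _).
Qed.

Lemma sum_adjacent x : \sum_y e x y = deg e x.
Proof.
by rewrite /deg -sum1dep_card [RHS]big_mkcond; apply: eq_bigr => y _; case: (e x y).
Qed.

Lemma sum_edges_from_ends_ge m H D :
  sigma2_ge e m -> uniq H ->
  all (fun ij => [&& ij.1 < size H, ij.2 < size H, ij.1 != ij.2 & ~~ edge_at H ij]) D ->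
  size D * m <= \sum_y edges_from (ends D) H y.
Proof.
move=> sigma uH /allP wfD; rewrite exchange_big big_cat !big_map /= -big_split /=.
rewrite -sum1_size big_distrl /= big_seq [leqRHS]big_seq leq_sum // => ij /wfD.
by case/and4P=> i1 i2 ne ni; rewrite !sum_adjacent mul1n sigma // nth_uniq.
Qed.

Hypotheses (e_sym : symmetric e) (e_irr : irreflexive e).

Lemma edge_at_adjacent l E ij :
  all (edge_at l) E -> adjacent E ij -> edge_at l ij.
Proof. by move=> /allP lE /orP[/lE//|/lE]; rewrite /edge_at e_sym. Qed.

Lemma realizes_embed P Q p l :
  embeds P Q p -> realizes l P -> exists2 l', perm_eq l l' & realizes l' Q.
Proof.
case/and4P=> /eqP nQ /allP wfQ perm_p /allP adjQ /andP[/eqP szl lP].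
have szp : size p = nverts Q by rewrite (perm_size perm_p) size_iota.
rewrite nQ -szl in perm_p; exists [seq nth x0 l i | i <- p].
  by rewrite perm_sym -[X in perm_eq _ X](mkseq_nth x0) perm_map.
rewrite /realizes size_map szp eqxx; apply/allP => ij ijQ.
have /andP[i1 i2] := wfQ _ ijQ.
rewrite /edge_at !(nth_map 0) ?szp // -/(edge_at l (_, _)).
by apply: edge_at_adjacent lP _; apply/adjQ/mapP; exists ij.
Qed.

Lemma leaves_embed P Q p ns : embeds P Q p -> leaves ns P -> leaves ns Q.
Proof.
move=> emb [H rH tH]; have [H' pH rH'] := realizes_embed emb rH.
by exists H' => //; apply: tiled_perm tH.
Qed.

Lemma leaves_reduces P K ns :
  reduces P K -> leaves ns P -> exists2 Q, Q \in unzip1 K & leaves ns Q.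
Proof.
case/hasP=> Qp QpK emb leaf; exists Qp.1; first exact: mem_rows.
exact: (leaves_embed emb leaf).
Qed.

Lemma leaves_absorbs P D A K ns H p :
  well_formed P -> all (fun i => i < nverts P) (ends D) ->
  absorbs P D (size p) A K -> realizes H P -> cycle e p ->
  A < \sum_(y <- p) edges_from (ends D) H y -> tiled ns (H ++ p) ->
  exists2 Q, Q \in unzip1 K & leaves ns Q.
Proof.
move=> wfP /allP ltD /andP[/allP embK unav] rH cyc lt_A tHp.
have /andP[/eqP szH _] := rH.
have sum_p : \sum_(y <- p) edges_from (ends D) H y =
    count (edge_at (H ++ p)) (cross (ends D) (iota (nverts P) (size p))).
  rewrite -sum_edges_from map_nth_iota; last by rewrite size_cat szH addKn.
  rewrite -szH drop_size_cat // take_size; apply: eq_bigr => y _.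
  by apply: eq_big_seq => i /ltD lt_i; rewrite nth_cat szH lt_i.
have /hasP[_ /mapP[[Q q] QqK ->] needed] : has (all (edge_at (H ++ p)))
    [seq needs (cross (undup (ends D)) (iota (nverts P) (size p))) Qq | Qq <- rows K].
  apply: unavoidableP unav _; rewrite sum_cross_undup; set absent := count _ _.
  have : count (edge_at (H ++ p)) (cross (ends D) (iota (nverts P) (size p)))
      + absent = size (ends D) * size p.
    by rewrite count_predC size_allpairs size_iota.
  by rewrite -sum_p; lia.
exists Q; first exact: (mem_rows QqK).
apply: leaves_embed (embK _ QqK) _; exists (H ++ p) => //.
rewrite realizes_add_edges needed realizes_union // -szH take_size_cat //.
by rewrite drop_size_cat // rH realizes_cycle eqxx cyc.
Qed.

Lemma leaves_augmentation X lengths m ns :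
  valid X lengths -> {subset ns <= lengths} -> sigma2_ge e m ->
  inner_bound X + \sum_(n <- ns) capacity X n < size (demand X) * m ->
  leaves ns (source X) ->
  (exists2 Q, Q \in unzip1 (shortcuts X) & leaves ns Q) \/
  exists (n : nat) (ns' : seq nat) (Q : graph),
    [/\ n \in lengths, perm_eq ns (n :: ns'), Q \in unzip1 (outcomes X n)
      & leaves ns' Q].
Proof.
case/and5P=> wf /allP wf_demand le_bound /allP short /allP absorb sub_ns sigma lt_m.
case=> H rH tH; have /andP[/eqP szH _] := rH.
have [/hasP[ij ijN e_ij]|/hasPn apart] := boolP (has (edge_at H) (nonedges X)).
  left; apply: leaves_reduces (short _ ijN) _; exists H => //.
  by rewrite realizes_add_edges rH /= e_ij.
have nonadjacent ij : adjacent (nonedges X) ij -> ~~ edge_at H ij.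
  by case/orP=> /apart //; rewrite /edge_at e_sym.
have inner : \sum_(y <- H) edges_from (ends (demand X)) H y <= inner_bound X.
  apply: leq_trans le_bound; rewrite -{1}[H](mkseq_nth x0) sum_edges_from szH.
  apply: sub_count => ij e_ij; rewrite (contraL (@nonadjacent ij) e_ij) andbT.
  by apply: contraTneq e_ij => ii; rewrite /edge_at ii e_irr.
have total : size (demand X) * m <= \sum_y edges_from (ends (demand X)) H y.
  apply: sum_edges_from_ends_ge sigma (tiled_uniq tH) _; apply/allP => ij ijD.
  have /and4P[i1 i2 neq_ij ijN] := wf_demand _ ijD; rewrite szH i1 i2 neq_ij.
  by apply: nonadjacent; rewrite /adjacent ijN.
have [|p [ns' [pns cyc lt_p tHp]]] :=
    @tiled_average (edges_from (ends (demand X)) H) (capacity X) _ _ tH.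
  by apply: leq_trans total; apply: leq_ltn_trans lt_m; rewrite leq_add2r.
have p_lengths : size p \in lengths by apply: sub_ns; rewrite (perm_mem pns) mem_head.
have [|Q Qout leaf] := leaves_absorbs wf _ (absorb _ p_lengths) rH cyc lt_p tHp.
  by rewrite all_cat !all_map; apply/andP; split; apply/allP => ij /wf_demand/and4P[].
by right; exists (size p), ns', Q.
Qed.

Lemma cycle_factor_paw ns :
  few_quads 0 ns -> sigma2_ge e (4 * (size ns).+1) -> leaves ns paw ->
  cycle_factor (4 :: ns).
Proof.
move=> few sigma leaf; apply: leaves_cycle.
have [|[Q]|[n [ns' [Q [_ pns]]]]] :=
    leaves_augmentation valid_paw_augmentation (few_quads_subset few) sigma _ leaf.
- rewrite (sum_by_length _ _ few) (size_few_quads few); case/andP: few => _ /=; lia.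
- by rewrite inE => /eqP->.
rewrite inE => /eqP-> /leaves_cycle_union; apply: leaves_perm.
by rewrite perm_sym.
Qed.

Lemma cycle_factor_path4 ns :
  few_quads 0 ns -> sigma2_ge e (4 * (size ns).+1) -> leaves ns (path_graph 4) ->
  cycle_factor (4 :: ns).
Proof.
move=> few sigma leaf.
have [|[Q]|[n [ns' [Q [_ pns]]]]] :=
    leaves_augmentation valid_path4_augmentation (few_quads_subset few) sigma _ leaf.
- rewrite (sum_by_length _ _ few) (size_few_quads few); case/andP: few => _ /=; lia.
- by rewrite !inE => /orP[]/eqP->; [apply: leaves_cycle | apply: cycle_factor_paw].
rewrite perm_sym in pns.
rewrite !inE => /orP[]/eqP-> /leaves_cycle_union/(leaves_perm pns).
  exact: cycle_factor_paw.
exact: leaves_cycle.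
Qed.

Lemma cycle_factor_bowl ns :
  few_quads 4 ns -> sigma2_ge e (4 * (size ns).+2) -> leaves ns bowl ->
  cycle_factor [:: 3, 3 & ns].
Proof.
move=> few sigma leaf.
have [|[Q]|[n [ns' [Q [n34 pns]]]]] :=
    leaves_augmentation valid_bowl_augmentation (few_quads_subset few) sigma _ leaf.
- rewrite (sum_by_length _ _ few) (size_few_quads few) /=; lia.
- by rewrite inE => /eqP-> /leaves_cycle_union/leaves_cycle.
rewrite inE => /eqP-> /leaves_cycle_union/leaves_cycle_union leaf'.
have p33 : perm_eq [:: n, 3, 3 & ns'] [:: 3, 3 & ns].
  by rewrite (perm_catCA [:: n] [:: 3; 3]) /= !perm_cons perm_sym.
apply: cycle_factor_perm p33 _; rewrite (few_quads_perm _ pns) in few.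
rewrite (perm_size pns) in sigma; move: n34 leaf' few; rewrite !inE => /orP[]/eqP->.
  by move/leaves_cycle.
by rewrite few_quads_cons4 -2!few_quads_cons3 => leaf' few; apply: cycle_factor_path4.
Qed.

Lemma cycle_factor_path3 ns :
  few_quads 3 ns -> sigma2_ge e (4 * (size ns).+1) -> leaves ns (path_graph 3) ->
  cycle_factor (3 :: ns).
Proof.
move=> few sigma leaf.
have [|[Q]|[n [ns' [Q [n34 pns QK leaf']]]]] :=
    leaves_augmentation valid_path3_augmentation (few_quads_subset few) sigma _ leaf.
- rewrite (sum_by_length _ _ few) (size_few_quads few) /=; lia.
- by rewrite inE => /eqP-> /leaves_cycle.
have p3 : perm_eq [:: n, 3 & ns'] (3 :: ns).
  by rewrite (perm_catCA [:: n] [:: 3]) /= perm_cons perm_sym.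
apply: cycle_factor_perm p3 _; rewrite (few_quads_perm _ pns) in few.
rewrite (perm_size pns) in sigma; move: n34 few QK leaf'; rewrite !inE => /orP[]/eqP->.
  by rewrite few_quads_cons3 inE => few /eqP->; apply: cycle_factor_bowl.
rewrite few_quads_cons4 -few_quads_cons3 inE => few /eqP-> /leaves_cycle_union.
exact: cycle_factor_path4.
Qed.

Lemma cycle_factor_path n ns :
  few_quads 2 (n :: ns) -> sigma2_ge e (4 * (size ns).+1) ->
  leaves ns (path_graph n) -> cycle_factor (n :: ns).
Proof.
move=> few; have := few_quads_subset few (mem_head n ns).
move: few; rewrite !inE => + /orP[]/eqP n_eq; rewrite {}n_eq.
  by rewrite few_quads_cons3; apply: cycle_factor_path3.
by rewrite few_quads_cons4; apply: cycle_factor_path4.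
Qed.

End Graph.

(** * Complete graphs and adding an edge *)

Section Complete.

Variables (T : finType) (e : rel T).
Hypothesis e_complete : forall x y, x != y -> e x y.

Lemma complete_cycle (p : seq T) : uniq p -> 1 < size p -> cycle e p.
Proof.
case: p => // x p uniq_p size_p; apply/(cycleP _ x) => i lt_i; apply: e_complete.
rewrite nth_uniq ?ltn_mod //; move: lt_i; rewrite leq_eqVlt => /predU1P[i_last|lt_i].
  by rewrite i_last modnn -lt0n -ltnS i_last.
by rewrite modn_small // neq_ltn ltnSn.
Qed.

Lemma complete_cycle_factor ns :
  all (leq 2) ns -> #|T| = sumn ns -> cycle_factor e ns.
Proof.
rewrite cardE => /allP ns2 szT; exists (reshape ns (enum T)).
  by rewrite reshapeKl ?szT.
rewrite /tiling reshapeKr ?szT // perm_refl andbT; apply/allP => p p_ps.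
apply: complete_cycle; last first.
  by apply: ns2; rewrite -(@reshapeKl _ ns (enum T)) ?szT // map_f.
have := enum_uniq T; rewrite -(@reshapeKr _ ns (enum T)) ?szT //.
by rewrite (perm_uniq (perm_flatten (perm_to_rem p_ps))) cat_uniq => /and3P[].
Qed.

End Complete.

Definition add_edge (T : finType) (e : rel T) (x y : T) : rel T :=
  fun u v => [|| e u v, (u == x) && (v == y) | (u == y) && (v == x)].

Section AddEdge.

Variables (T : finType) (e : rel T) (x y : T).
Hypothesis e_sym : symmetric e.

Lemma add_edge_sym : symmetric (add_edge e x y).
Proof.
move=> u v; rewrite /add_edge e_sym; congr (_ || _).
by rewrite orbC ![(v == _) && _]andbC.
Qed.

Lemma add_edge_irr : x != y -> irreflexive e -> irreflexive (add_edge e x y).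
Proof.
move=> neq_xy e_irr u; rewrite /add_edge e_irr.
by case: (u =P x) => [->|_]; rewrite ?(negbTE neq_xy) ?andbF.
Qed.

Lemma add_edge_sigma m : sigma2_ge e m -> sigma2_ge (add_edge e x y) m.
Proof.
move=> sigma u v uv; rewrite negb_or => /andP[nuv _].
have le_deg w : deg e w <= deg (add_edge e x y) w.
  by apply/subset_leq_card/subsetP => z; rewrite !inE /add_edge => ->.
exact: leq_trans (sigma _ _ uv nuv) (leq_add _ _).
Qed.

Lemma add_edge_avoid : {in predC1 x &, subrel (add_edge e x y) e}.
Proof.
by move=> u v; rewrite !inE /add_edge => /negbTE-> /negbTE->; rewrite andbF !orbF.
Qed.

Lemma add_edge_from v : v != y -> add_edge e x y x v -> e x v.
Proof.
rewrite /add_edge => /negbTE nvy; rewrite nvy andbF /=.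
by case: (x =P y) nvy => [->|_] nvy; rewrite ?nvy !orbF.
Qed.

Lemma add_edge_cycle p :
  uniq p -> x \in p -> 2 < size p -> cycle (add_edge e x y) p ->
  cycle e p \/ exists2 q, perm_eq p q & sorted e q.
Proof.
move=> + /rot_to[i q rot_p]; rewrite -(rot_cycle i) -(rot_uniq i) -(size_rot i).
rewrite -(rot_cycle i e) rot_p; have {rot_p} pq : perm_eq p (x :: q).
  by rewrite -rot_p perm_sym perm_rot.
case: q pq => [|a q] //; case/lastP: q => [|q b] // pq.
rewrite /= !(rcons_path _ _ (rcons q b)) last_rcons !inE !mem_rcons !inE !negb_or.
case/and3P=> /and3P[neq_xa neq_xb xq] /andP[neq_ab _] _ _ /and3P[e_xa e_aqb e_bx].
have {}e_aqb : path e a (rcons q b).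
  apply: (sub_in_path add_edge_avoid) e_aqb.
  rewrite /= all_rcons !inE ![_ == x]eq_sym neq_xa neq_xb /=.
  by apply/allP => u uq; rewrite inE; apply: contraNneq xq => <-.
rewrite add_edge_sym in e_bx.
have [eq_ay|neq_ay] := eqVneq a y; last have [eq_by|neq_by] := eqVneq b y.
- right; exists (a :: rcons (rcons q b) x).
    by apply: perm_trans pq _; rewrite -cat1s perm_catC cats1.
  rewrite /= rcons_path last_rcons e_aqb e_sym add_edge_from //.
  by rewrite -eq_ay eq_sym.
- by right; exists [:: x, a & rcons q b] => //=; rewrite add_edge_from.
by left; rewrite !add_edge_from // e_aqb e_sym add_edge_from.
Qed.

Lemma add_edge_cycle_factor ns :
  all (leq 3) ns -> cycle_factor (add_edge e x y) ns ->
  cycle_factor e ns \/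
  exists n ns', perm_eq ns (n :: ns') /\ leaves e x ns' (path_graph n).
Proof.
move=> /allP ns3 [ps pns tps].
have /flattenP[p p_ps xp] : x \in flatten ps.
  by have /andP[_ /perm_mem->] := tps; rewrite mem_enum.
have {}pns := perm_shape_rem p_ps pns.
have /andP[/allP cyc _] := tps.
have /andP[_ pT'] := tiling_rem p_ps tps.
have : uniq (p ++ flatten (rem p ps)) by rewrite (perm_uniq pT') enum_uniq.
rewrite cat_uniq => /and3P[uniq_p /hasPn disj _].
have tiled_p : tiled e (shape (rem p ps)) p.
  exists (rem p ps) => //; rewrite /tiling pT' andbT; apply/allP => q q_ps.
  apply: (sub_in_cycle add_edge_avoid) (cyc _ (mem_rem q_ps)).
  apply/allP => u uq; rewrite inE; apply: contraTneq xp => <-.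
  by apply: disj; apply/flattenP; exists q.
have size_p : 2 < size p by apply: ns3; rewrite (perm_mem pns) mem_head.
have [cyc_p|[q pq path_q]] := add_edge_cycle uniq_p xp size_p (cyc _ p_ps).
  left; rewrite perm_sym in pns; apply: cycle_factor_perm pns _.
  by apply: tiled_cycle; rewrite ?cats0.
right; exists (size p), (shape (rem p ps)); split=> //; exists q.
  by rewrite realizes_path (perm_size pq) eqxx.
exact: tiled_perm tiled_p.
Qed.

End AddEdge.

Lemma sigma2_cycle_factor (T : finType) (e : rel T) (ns : seq nat) :
  symmetric e -> irreflexive e -> few_quads 2 ns -> #|T| = sumn ns ->
  sigma2_ge e (4 * size ns) -> cycle_factor e ns.
Proof.
move=> + + few cT; have [m] := ubnP #|[set p : T * T | ~~ e p.1 p.2]|.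
have ns3 : all (leq 3) ns.
  by apply/allP => n /(few_quads_subset few); rewrite !inE => /orP[]/eqP->.
elim: m e => // m IHm e lt_m e_sym e_irr sigma.
have [/existsP[[x y] /andP[/= nxy nexy]]|] :=
    boolP [exists p : T * T, (p.1 != p.2) && ~~ e p.1 p.2]; last first.
  rewrite negb_exists => /forallP complete.
  apply: complete_cycle_factor cT; last by apply: sub_all ns3 => n /ltnW.
  by move=> x y nxy; have := complete (x, y); rewrite /= nxy negbK.
have factor_add : cycle_factor (add_edge e x y) ns.
  apply: IHm; [|exact: add_edge_sym|exact: add_edge_irr|exact: add_edge_sigma].
  rewrite -ltnS; apply: leq_trans lt_m; rewrite ltnS; apply: proper_card.
  apply/properP; split.
    by apply/subsetP => p; rewrite !inE /add_edge negb_or => /andP[].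
  by exists (x, y); rewrite !inE //= /add_edge !eqxx orbT.
have [//|[n [ns' [pns leaf]]]] := add_edge_cycle_factor e_sym ns3 factor_add.
rewrite (few_quads_perm _ pns) in few; rewrite (perm_size pns) in sigma.
rewrite perm_sym in pns; apply: cycle_factor_perm pns _.
exact: cycle_factor_path leaf.
Qed.

(** * Labelling the cycles *)

Section Labelling.

Variables (T : eqType) (x0 : T).

Lemma nth_flatten_index (ps : seq (seq T)) i j : j < size (nth [::] ps i) ->
  nth x0 (flatten ps) (flatten_index (shape ps) i j) = nth x0 (nth [::] ps i) j.
Proof.
by rewrite -nth_shape => lt_j; rewrite nth_flatten flatten_indexKl ?flatten_indexKr.
Qed.

Lemma uniq_flatten_nth (ps : seq (seq T)) i j i' j' :
  uniq (flatten ps) -> j < size (nth [::] ps i) -> j' < size (nth [::] ps i') ->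
  nth x0 (nth [::] ps i) j = nth x0 (nth [::] ps i') j' -> i = i' /\ j = j'.
Proof.
move=> uniq_ps lt_j lt_j' /eqP; rewrite -!nth_flatten_index //.
rewrite -!nth_shape in lt_j lt_j'.
rewrite nth_uniq ?size_flatten ?flatten_indexP // => /eqP eq_index.
split; first by rewrite -(flatten_indexKl lt_j) eq_index flatten_indexKl.
by rewrite -(flatten_indexKr lt_j) eq_index flatten_indexKr.
Qed.

End Labelling.

Lemma tiled_shape (T : finType) (e : rel T) (ns : seq nat) (H : seq T) :
  tiled e ns H -> exists2 ps, shape ps = ns & tiling e ps H.
Proof.
case=> ps; rewrite perm_sym => /(perm_iotaP 0)[Is pIs ->] /andP[/allP cyc pT].
have pps : perm_eq [seq nth [::] ps i | i <- Is] ps.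
  by rewrite -[X in perm_eq _ X](mkseq_nth [::]) perm_map // -(size_map size).
exists [seq nth [::] ps i | i <- Is].
  by rewrite /shape -map_comp; apply: eq_map => i; rewrite /= -nth_shape.
apply/andP; split; first by apply/allP => p; rewrite (perm_mem pps) => /cyc.
by apply: perm_trans pT; rewrite perm_cat2l; apply: perm_flatten.
Qed.

Lemma cycle_factor_contains (T : finType) (e : rel T) (x0 : T) (r s : nat) :
  cycle_factor e (nseq r 3 ++ nseq s 4) -> contains_rC3_sC4 e r s.
Proof.
case/tiled_shape=> ps shape_ps /andP[/allP cyc pT].
have uniq_ps : uniq (flatten ps) by rewrite (perm_uniq pT) enum_uniq.
have size_ps k : size (nth [::] ps k) = nth 0 (nseq r 3 ++ nseq s 4) k.
  by rewrite -nth_shape shape_ps.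
have size_triangle (i : 'I_r) : size (nth [::] ps (lshift s i)) = 3.
  by rewrite size_ps nth_cat size_nseq /= ltn_ord nth_nseq ltn_ord.
have size_quad (i : 'I_s) : size (nth [::] ps (rshift r i)) = 4.
  by rewrite size_ps nth_cat size_nseq /= ltnNge leq_addr addKn /= nth_nseq ltn_ord.
have edge k n : size (nth [::] ps k) = n -> forall j : 'I_n,
    e (nth x0 (nth [::] ps k) j) (nth x0 (nth [::] ps k) (ordS j)).
  have /(cycleP _ x0) cyc_k : cycle e (nth [::] ps k).
    have [lt_k|ge_k] := ltnP k (size ps); first by apply/cyc/mem_nth.
    by rewrite nth_default.
  by move=> <- j; apply: cyc_k.
pose f (a : 'I_r * 'I_3 + 'I_s * 'I_4) : T :=
  match a with
  | inl (i, j) => nth x0 (nth [::] ps (lshift s i)) j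
  | inr (i, j) => nth x0 (nth [::] ps (rshift r i)) j
  end.
exists f; split; last by split=> i j; exact: edge.
move=> [] [i j] [] [i' j'] /= /(uniq_flatten_nth uniq_ps);
  rewrite !(size_triangle, size_quad) => -[] //= eq_i eq_j.
- by rewrite (val_inj eq_i) (val_inj eq_j).
- by have := ltn_ord i; lia.
- by have := ltn_ord i'; lia.
by rewrite (val_inj (addnI eq_i)) (val_inj eq_j).
Qed.

Theorem theorem2 (r s : nat) (T : finType) (e : rel T) :
  0 < r -> 0 < s -> 2 * s - 2 <= r ->
  simple_graph e ->
  #|T| = 3 * r + 4 * s ->
  sigma2_ge e (#|T| + r) ->
  contains_rC3_sC4 e r s.
Proof.
move=> r_gt0 _ rs [e_sym e_irr] cT sigma.
have /card_gt0P[x0 _] : 0 < #|T| by lia.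
apply: (cycle_factor_contains x0); apply: sigma2_cycle_factor => //.
- by rewrite /few_quads all_cat !all_nseq !count_cat !count_nseq !orbT /=; lia.
- by rewrite sumn_cat !sumn_nseq.
by rewrite size_cat !size_nseq; have <- : #|T| + r = 4 * (r + s) by lia.
Qed.
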